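(* Let $X$ be a connected Alexandroff paratopological group and let $G$ be a topological group. If $f\colon X\to G$ is a continuous group homomorphism, then $f(X)$, with the subspace topology inherited from $G$, carries the trivial (indiscrete) topology.
   Context: An Alexandroff space is a topological space in which arbitrary intersections of open sets are open. A paratopological group is a group endowed with a topology for which the multiplication map $X\times X\to X$ is continuous (inversion need not be continuous). A topological group is a group endowed with a topology for which both multiplication and inversion are continuous. No separation axioms are assumed for paratopological or topological groups. An Alexandroff paratopological group is a paratopological group whose topology is Alexandroff. *)

(* Defs.v *)
From HB Require Import structures.
From mathcomp Require Import all_boot.
From mathcomp Require Import all_classical topology.

Set Implicit Arguments.
Unset Strict Implicit.
Unset Printing Implicit Defensive.

Local Open Scope classical_set_scope.

(* Multiplicative, not necessarily abelian, counterparts of the additive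
   topological structures of MathComp-Analysis. *)

#[short(type="preTopologicalGroupType")]
HB.structure Definition PreTopologicalGroup := {X of Topological X & Group X}.

HB.mixin Record PreTopologicalGroup_isParatopological X
    of PreTopologicalGroup X := {
  mulg_continuous : continuous (fun z : X * X => (z.1 * z.2)%g)
}.

#[short(type="paratopologicalGroupType")]
HB.structure Definition ParatopologicalGroup :=
  {X of PreTopologicalGroup X & PreTopologicalGroup_isParatopological X}.

HB.mixin Record Paratopological_isTopologicalGroup X
    of ParatopologicalGroup X := {
  invg_continuous : continuous (fun x : X => x^-1%g)
}.

#[short(type="topologicalGroupType")]
HB.structure Definition TopologicalGroup :=
  {X of ParatopologicalGroup X & Paratopological_isTopologicalGroup X}.

Definition alexandroff (T : topologicalType) : Prop :=
  forall F : set (set T), F `<=` open -> open (\bigcap_(U in F) U).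

Definition indiscrete (T : topologicalType) : Prop :=
  @open T = [set set0; setT].

(* Main.v *)
(* Minimal neighbourhoods make the sets on which [f] is topologically
   indistinguishable from a given point clopen in [X], because the
   specialization preorder of a topological group is symmetric (a topological
   group is R0). *)
Require Import Defs.
From mathcomp Require Import all_boot.
From mathcomp Require Import all_classical topology.

Local Open Scope classical_set_scope.

(** The specialization preorder: [x] lies in the closure of [y]. It is one-sided, which is all that
    a minimal neighbourhood of [x] provides. *)
Definition inseparable_from {T : topologicalType} (x y : T) : Prop :=
  forall V : set T, open V -> V x -> V y.

Lemma open_preimage {S T : topologicalType} {f : S -> T} {V : set T} :
  continuous f -> open V -> open (f @^-1` V).
Proof. by move=> fc; apply: open_comp => x _; exact: fc. Qed.

(** The continuous map [h] sending [w] to [x * (w^-1 * y)] swaps [x] and [y], so applying the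
    hypothesis to the preimage of [V] under [h] reverses the roles of the two points. *)
Lemma inseparable_from_sym {G : topologicalGroupType} {x y : G} :
  inseparable_from x y -> inseparable_from y x.
Proof.
move=> xy V oV Vy.
pose h (w : G) : G := (x * (w^-1 * y))%g.
have hc : continuous h.
  move=> w; apply: (continuous_comp (g := fun z : G * G => (z.1 * z.2)%g)
    (f := fun w : G => (x, (w^-1 * y)%g))); last exact: mulg_continuous.
  apply: cvg_pair; first exact: cvg_cst.
  apply: (continuous_comp (g := fun z : G * G => (z.1 * z.2)%g)
    (f := fun w : G => (w^-1%g, y))); last exact: mulg_continuous.
  by apply: cvg_pair; [exact: invg_continuous|exact: cvg_cst].
have /= := xy (h @^-1` V) (open_preimage hc oV).
by rewrite /h /= mulVg mulg1 mulVKg => /(_ Vy).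
Qed.

Lemma alexandroff_locally_inseparable {X : topologicalType} (x : X) :
  alexandroff X -> nbhs x (inseparable_from x).
Proof.
move=> aX; rewrite nbhsE.
(* The minimal neighbourhood of [x], open by the Alexandroff property. *)
exists (\bigcap_(U in [set U : set X | open U /\ U x]) U).
  by split; [apply: aX => U []|move=> U []].
by move=> y Hy V oV Vx; apply: Hy.
Qed.

Lemma alexandroff_connected_inseparable {X : topologicalType}
    {G : topologicalGroupType} (f : X -> G) :
  connected [set: X] -> alexandroff X -> continuous f ->
  forall x y, inseparable_from (f x) (f y).
Proof.
move=> cX aX fc x.
pose H := [set y | inseparable_from (f x) (f y)].
have f_insep y z : inseparable_from y z -> inseparable_from (f y) (f z).
  by move=> yz V oV; exact: yz (open_preimage fc oV).
(* By transitivity of the preorder, [H] contains the minimal neighbourhood of each of its points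
   [y]. *)
have oH : open H.
  rewrite openE => y Hy; apply: filterS (alexandroff_locally_inseparable y aX).
  by move=> z /f_insep yz V oV /(Hy V oV); exact: yz.
(* If [z] in the minimal neighbourhood of [y] were in [H], then symmetry in [G] would lead back from
   [f z] to [f y] and put [y] in [H]. *)
have cH : closed H.
  rewrite -openC openE => y nHy.
  apply: filterS (alexandroff_locally_inseparable y aX).
  move=> z /f_insep /inseparable_from_sym zy Hz; apply: nHy => V oV /(Hz V oV).
  exact: zy.
have HT : H = [set: X].
  apply: cX; first by exists x.
  - by exists H => //; rewrite setTI.
  - by exists H => //; rewrite setTI.
by move=> y; have : [set: X] y by []; rewrite -HT.
Qed.

Theorem theorem3p4 (X : paratopologicalGroupType) (G : topologicalGroupType)
    (f : {multiplicative X -> G}) :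
  connected [set: X] -> alexandroff X -> continuous f ->
  indiscrete (set_type (range f)).
Proof.
move=> cX aX fc; apply/seteqP; split => [U [V oV <-]|U [] ->]; last 2 first.
- exact: open0.
- exact: openT.
(* An open set of the subspace is the trace of some open [V] of [G]; as [V] cannot separate two
   values of [f], this trace is empty or everything. *)
have V_const (u v : set_type (range f)) : V (set_val u) -> V (set_val v).
  have [x _ fx] := set_valP u; have [y _ fy] := set_valP v.
  have := alexandroff_connected_inseparable f cX aX fc x y V oV.
  by rewrite fx fy.
have [[u Vu]|V0] := pselect (exists u : set_type (range f), V (set_val u)).
- by right; apply/seteqP; split => // v _; exact: V_const Vu.
- by left; apply/seteqP; split => // u Vu; apply: V0; exists u.
Qed.
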